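(* Let $I$ be a spherical subset of $S$, let $J\subseteq S$, and let $A\in X_I$. If $w\in R(I,J)$ then $$|F(A,J,w)|=\frac{N(I)}{N(I\cap wJw^{-1})}\,q_w .$$
   Context: Let $(W,S)$ be a Coxeter system with $S$ finite and length function $\ell$. For $I\subseteq S$ let $W_I$ be the subgroup generated by $I$; $I$ is called spherical if $W_I$ is finite. For $I,J\subseteq S$, $R(I,J)$ denotes the set of elements $w\in W$ which are the (unique) minimal-length element of their double coset $W_IwW_J$. Let $X$ be a building of type $(W,S)$, regarded as a simplicial complex with a type function $\tau$ (each simplex $A$ has type $\tau(A)\subseteq S$, chambers have type $S$), with chamber set $\mathcal{C}$ and Weyl distance $\delta:\mathcal{C}\times\mathcal{C}\to W$. The cotype of a simplex $A$ is $S\setminus\tau(A)$, and $X_I$ denotes the set of simplices of cotype $I$ (so $X_\emptyset=\mathcal{C}$). For a simplex $A$ let $\mathcal{C}(A)$ be the set of chambers having $A$ as a face. For $A\in X_I$ and $B\in X_J$ the set $\delta(\mathcal{C}(A)\times\mathcal{C}(B))$ is a single double coset $W_IwW_J$, and $\delta(A,B)$ is defined to be its unique element lying in $R(I,J)$. The building $X$ is assumed locally finite and regular: for each $s\in S$ there is an integer $q_s\ge1$ such that every panel of cotype $\{s\}$ is a face of exactly $q_s+1$ chambers. For $w\in W$ with a reduced expression $w=s_1\cdots s_k$ put $q_w=q_{s_1}\cdots q_{s_k}$ (this is independent of the reduced expression, and $q_1=1$). For spherical $K\subseteq S$ put $N(K)=\sum_{v\in W_K}q_v$. For $A\in X_I$,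 $J\subseteq S$ and $w\in R(I,J)$, the generalised sphere is $F(A,J,w)=\{B\in X_J:\delta(A,B)=w\}$. *)

(* Defs.v *)
From HB Require Import structures.
From mathcomp Require Import all_boot all_order all_algebra.
From mathcomp Require Import all_classical.

Set Implicit Arguments.
Unset Strict Implicit.
Unset Printing Implicit Defensive.

Local Open Scope classical_set_scope.
Local Open Scope card_scope.
Local Open Scope group_scope.

Section Coxeter.
Context (W : groupType) (S : finType) (gen : S -> W).

Definition subgroup (H : set W) : Prop := group_closed (mem H).

Definition parabolic (I : {set S}) : set W := smallest subgroup (gen @` [set` I]).

(* The distinguished generating subset of [W] is the image of [gen], indexed by
   the finite type [S].  The last clause is the universal property of the
   presentation of [W] by the generators [S] and the relations
   [(st)^m(s,t) = 1], [m(s,t)] being the order of [st] whenever it is finite;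
   the relations [(st)^n = 1] with [n] a multiple of [m(s,t)] add nothing. *)
Definition coxeter_system : Prop :=
  [/\ injective gen,
      forall s, gen s <> 1 /\ gen s ^+ 2 = 1,
      parabolic [set: S]%SET = setT
    & forall (G : groupType) (f : S -> G),
        (forall s t n, (gen s * gen t) ^+ n = 1 -> (f s * f t) ^+ n = 1) ->
        exists phi : {multiplicative W -> G}, forall s, phi (gen s) = f s].

Definition wprod (r : seq S) : W := \prod_(s <- r) gen s.

Definition reduced_word (w : W) (r : seq S) : Prop :=
  wprod r = w /\ forall r', wprod r' = w -> (size r <= size r')%N.

Definition redword (w : W) : seq S := xget [::] [set r | reduced_word w r].

Definition len (w : W) : nat := size (redword w).

Definition spherical (I : {set S}) : Prop := finite_set (parabolic I).

Definition dcoset (I J : {set S}) (w : W) : set W :=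
  [set u * w * v | u in parabolic I & v in parabolic J].

Definition mindcoset (I J : {set S}) : set W :=
  [set w | forall v, dcoset I J w v -> v <> w -> (len w < len v)%N].

(* I :&: w J w^-1, computed in [W] and read back in [S] *)
Definition capconj (I : {set S}) (w : W) (J : {set S}) : {set S} :=
  [set s in I | [exists t in J, gen s == w * gen t * w^-1]]%SET.

Definition qprod (q : S -> nat) (w : W) : nat := (\prod_(s <- redword w) q s)%N.

(* The finitely supported sum is the plain one only for spherical [K]. *)
Definition qsum (q : S -> nat) (K : {set S}) : nat :=
  \big[addn/0%N]_(v \in parabolic K) qprod q v.

End Coxeter.

Record typed_complex (S : finType) := TypedComplex {
  vertex : Type;
  vtype : vertex -> S;
  simplex : set (set vertex);
  simplex_vertex : forall v, simplex [set v];
  simplex_face : forall A B, simplex A -> B `<=` A -> simplex B;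
  (* distinct vertices of a simplex have distinct types; in particular
     simplices are finite *)
  simplex_vtype : forall A u v,
    simplex A -> A u -> A v -> vtype u = vtype v -> u = v;
  (* every simplex is a face of a simplex of type S *)
  simplex_chamber : forall A, simplex A ->
    exists C, [/\ simplex C, A `<=` C & forall s, exists2 v, C v & vtype v = s]
}.

Section Complex.
Context (S : finType) (X : typed_complex S).

Definition stype (A : set (vertex X)) : {set S} :=
  [set s | `[< exists2 v, A v & vtype v = s >]]%SET.

Definition cotype (A : set (vertex X)) : {set S} := (~: stype A)%SET.

Definition simplices (I : {set S}) : set (set (vertex X)) :=
  [set A | simplex A /\ cotype A = I].

Definition chambers : set (set (vertex X)) := simplices finset.set0.

Definition chambers_at (A : set (vertex X)) : set (set (vertex X)) :=
  [set C | chambers C /\ A `<=` C].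

Definition regular (q : S -> nat) : Prop :=
  forall s, (1 <= q s)%N /\
    forall P, simplices [set s]%SET P -> chambers_at P #= `I_(q s).+1.

End Complex.

Section Building.
Context (W : groupType) (S : finType) (gen : S -> W) (X : typed_complex S).
Context (delta : set (vertex X) -> set (vertex X) -> W).

(* [delta] is only relevant on chambers.  The first four clauses are the axioms
   of a building of type (W, S) as a chamber set with a W-valued distance
   (Abramenko-Brown, Buildings, Definition 5.1).  The last one says that X is
   the simplicial complex of that building: the chambers having a given simplex
   of cotype I as a face form an I-residue.  As every chamber has a unique face
   of each cotype, A |-> chambers_at A is then an inclusion-reversing bijection
   from the simplices of cotype I onto the I-residues. *)
Definition building : Prop :=
  [/\ exists C : set (vertex X), chambers C,
      forall C D, chambers C -> chambers D -> (delta C D = 1 <-> C = D),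
      forall C D C' s, chambers C -> chambers D -> chambers C' ->
        delta C' C = gen s ->
        (delta C' D = gen s * delta C D \/ delta C' D = delta C D) /\
        (len gen (gen s * delta C D) = (len gen (delta C D)).+1 ->
         delta C' D = gen s * delta C D),
      forall C D s, chambers C -> chambers D ->
        exists C', [/\ chambers C', delta C' C = gen s
                     & delta C' D = gen s * delta C D]
    & forall I A C, simplices I A -> chambers_at A C ->
        chambers_at A = [set D | chambers D /\ parabolic gen I (delta C D)]].

(* The element of R(I, J) lying in the double coset delta(C(A) x C(B)), for
   A of cotype I and B of cotype J. *)
Definition sdelta (A B : set (vertex X)) : W :=
  xget 1 [set w | mindcoset gen (cotype A) (cotype B) w /\
    exists C D, [/\ chambers_at A C, chambers_at B D & delta C D = w]].

Definition gsphere (A : set (vertex X)) (J : {set S}) (w : W) :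
    set (set (vertex X)) :=
  [set B | simplices J B /\ sdelta A B = w].

End Building.

(* Main.v *)
(* Count in two ways the pairs (C, D) of chambers with C in C(A)
   and delta(C, D) = w.  Given C there are q_w choices of D, and |C(A)| = N(I).
   On the other hand D determines a face B of cotype J, which lies in F(A, J, w),
   and given B the possible C (each of which determines D, lengths adding up in
   w W_J) form a residue of type I :&: w J w^-1, by Kilmoyer's description of
   W_I :&: w W_J w^-1.  The combinatorics of W rests on the exchange condition,
   obtained from the presentation of W: the parity with which a reflection
   occurs in a word depends only on the product of the word, because it is a
   cocycle respecting the dihedral relations. *)
Require Import Defs.
From HB Require Import structures.
From mathcomp Require Import all_boot all_order finmap all_algebra zify.
From mathcomp Require Import all_classical.

Set Implicit Arguments.
Unset Strict Implicit.
Unset Printing Implicit Defensive.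

Import GRing.Theory.
Local Open Scope classical_set_scope.
Local Open Scope card_scope.

(** * The reflection cocycle *)

Section ReflectionCocycle.
Local Open Scope group_scope.
Variable W : groupType.

(* The semidirect product of the boolean functions on [W] by [W], which acts on
   them by conjugation of the argument. *)
Definition conj_ext : Type := (W * (W -> bool))%type.

HB.instance Definition _ := Choice.on conj_ext.

Definition conj_ext_mul (x y : conj_ext) : conj_ext :=
  (x.1 * y.1, fun t => x.2 t (+) y.2 (t ^ x.1)).
Definition conj_ext_one : conj_ext := (1, fun=> false).
Definition conj_ext_inv (x : conj_ext) : conj_ext :=
  (x.1^-1, fun t => x.2 (t ^ x.1^-1)).

Lemma conj_ext_mulA : associative conj_ext_mul.
Proof.
move=> x y z; congr (_, _) => /=; first by rewrite mulgA.
by apply/funext => t; rewrite /= conjgM addbA.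
Qed.

Lemma conj_ext_mul1x : left_id conj_ext_one conj_ext_mul.
Proof.
by move=> [w N]; congr (_, _); rewrite /= ?mul1g//; apply/funext=> t; rewrite conjg1.
Qed.

Lemma conj_ext_mulx1 : right_id conj_ext_one conj_ext_mul.
Proof.
by move=> [w N]; congr (_, _); rewrite /= ?mulg1//; apply/funext=> t; rewrite addbF.
Qed.

Lemma conj_ext_mulVx : left_inverse conj_ext_one conj_ext_inv conj_ext_mul.
Proof.
by move=> [w N]; congr (_, _); rewrite /= ?mulVg//; apply/funext=> t; rewrite addbb.
Qed.

Lemma conj_ext_mulxV : right_inverse conj_ext_one conj_ext_inv conj_ext_mul.
Proof.
move=> [w N]; congr (_, _); rewrite /= ?mulgV//.
by apply/funext=> t; rewrite conjgK addbb.
Qed.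

HB.instance Definition _ := isGroup.Build conj_ext
  conj_ext_mulA conj_ext_mul1x conj_ext_mulx1 conj_ext_mulVx conj_ext_mulxV.

Lemma conj_ext_mulE (x y : conj_ext) :
  x * y = (x.1 * y.1, fun t => x.2 t (+) y.2 (t ^ x.1)) :> conj_ext.
Proof. by []. Qed.

Lemma conj_ext_expE (x : conj_ext) n : (x ^+ n).1 = x.1 ^+ n.
Proof. by elim: n => // n IHn; rewrite !expgS conj_ext_mulE /= IHn. Qed.

(** At [u], the boolean part of the power counts modulo 2 the indices [i < 2n] with
    [u = (s * t) ^+ i * s]. As [(s * t) ^+ n = 1], the indices [i] and [i + n] give the same
    reflection, so the total is even. *)
Lemma conj_ext_dihedral (s t : W) n : s * s = 1 -> t * t = 1 ->
    (s * t) ^+ n = 1 ->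
  (((s, eq_op^~ s) : conj_ext) * ((t, eq_op^~ t) : conj_ext)) ^+ n = 1.
Proof.
move=> ss tt stn; set x := (_ * _).
have x1 : x.1 = s * t by [].
have sV : s^-1 = s by apply: mulg1_eq.
have tV : t^-1 = t by apply: mulg1_eq.
have spV k : s * (s * t) ^- k = (s * t) ^+ k * s.
  have <- : (t * s) ^+ k = (s * t) ^- k by rewrite -expVgn invgM sV tV.
  elim: k => [|k IHk]; first by rewrite !expg0 mul1g mulg1.
  by rewrite expgSr mulgA IHk expgSr -!mulgA.
have conjE (a b c : W) : (a ^ b == c) = (a == b * (c * b^-1)).
  apply/eqP/eqP => [<-|->]; rewrite conjgE.
    by rewrite !mulgA mulgV mul1g mulgK.
  by rewrite -!mulgA mulKg mulVg mulg1.
(* The k-th reflection of the word [stst...] is [(st)^k s]. *)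
have x2 k u :
    (x ^+ k).2 u = \big[addb/false]_(0 <= i < k.*2) (u == (s * t) ^+ i * s).
  elim: k => [|k IHk]; first by rewrite big_geq.
  rewrite expgSr conj_ext_mulE /= IHk doubleS !big_nat_recr //= -addbA.
  rewrite conj_ext_expE x1; congr (_ (+) (_ (+) _)).
    by rewrite conjE spV -addnn expgnDr mulgA.
  by rewrite !conjE sV -!mulgA spV -addnn -addnS expgnDr expgS -!mulgA.
apply/eqP; rewrite -pair_eqE /= ; apply/andP; split.
  by rewrite conj_ext_expE x1 stn.
apply/eqP/funext => u; rewrite x2 -addnn.
rewrite (@big_cat_nat _ _ _ n) ?leq_addr //= -{2}[n]add0n big_addn addnK.
rewrite [X in _ (+) X](eq_bigr (fun i => u == (s * t) ^+ i * s)) ?addbb//.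
by move=> i _; rewrite expgnDr stn mulg1.
Qed.

End ReflectionCocycle.

(** * Coxeter groups *)

Lemma subseq_cat_split (T : eqType) (r r1 r2 : seq T) :
  subseq r (r1 ++ r2) ->
  exists r1' r2', [/\ r = r1' ++ r2', subseq r1' r1 & subseq r2' r2].
Proof.
move=> /subseqP[m sm ->]; rewrite -[m](cat_take_drop (size r1)).
rewrite mask_cat ?size_takel ?sm ?size_cat ?leq_addr//.
by do 2 eexists; split; [reflexivity|exact: mask_subseq..].
Qed.

Lemma cat_cons_split (T : Type) (r1 r2 b c : seq T) t : b ++ c = r1 ++ t :: r2 ->
  (exists2 b2, b = r1 ++ t :: b2 & r2 = b2 ++ c) \/
  (exists2 c1, c = c1 ++ t :: r2 & r1 = b ++ c1).
Proof.
elim: b r1 => [|x b IHb] [|y r1] /=.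
- by move=> ->; right; exists [::].
- by move=> ->; right; exists (y :: r1).
- by case=> -> <-; left; exists b.
- by case=> -> /IHb[[b2 -> ->]|[c1 -> ->]]; [left; exists b2|right; exists c1].
Qed.

Section CoxeterGroups.
Local Open Scope group_scope.
Variables (W : groupType) (S : finType) (gen : S -> W).
Hypothesis cox : coxeter_system gen.
Implicit Types (s t : S) (r : seq S) (u v w x : W) (I J K : {set S}).

Local Notation wp := (wprod gen).
Local Notation l := (len gen).

(** * Words, parabolic subgroups and length *)

Lemma gen_neq1 s : gen s <> 1. Proof. by case: cox => _ /(_ s)[]. Qed.

Lemma gen2 s : gen s * gen s = 1.
Proof. by case: cox => _ /(_ s)[_]; rewrite expg2. Qed.

Lemma genV s : (gen s)^-1 = gen s. Proof. by apply: mulg1_eq; rewrite gen2. Qed.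

Lemma genK s x : gen s * (gen s * x) = x.
Proof. by rewrite mulgA gen2 mul1g. Qed.

Lemma wprod_nil : wp [::] = 1. Proof. by rewrite /wprod big_nil. Qed.

Lemma wprod_cons s r : wp (s :: r) = gen s * wp r.
Proof. by rewrite /wprod big_cons. Qed.

Lemma wprod1 s : wp [:: s] = gen s.
Proof. by rewrite wprod_cons wprod_nil mulg1. Qed.

Lemma wprod_cat r r' : wp (r ++ r') = wp r * wp r'.
Proof. by rewrite /wprod big_cat. Qed.

Lemma wprod_rev r : wp (rev r) = (wp r)^-1.
Proof.
elim: r => [|s r IHr]; first by rewrite wprod_nil invg1.
by rewrite rev_cons -cats1 wprod_cat IHr wprod1 wprod_cons invgM genV.
Qed.

Local Notation word_in I r := (all (mem I) r).

(** The generators are involutions, so reversing a word inverts its product: the products of words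
    in [I] already form a subgroup. *)
Lemma parabolic_word I w :
  parabolic gen I w <-> exists2 r, word_in I r & wp r = w.
Proof.
split.
  move=> /(_ [set w | exists2 r, word_in I r & wp r = w]); apply; split.
    split; first by rewrite inE; exists [::]; rewrite ?wprod_nil.
    move=> x y; rewrite !inE => -[r Ir <-] [r' Ir' <-].
    exists (r ++ rev r'); first by rewrite all_cat all_rev Ir.
    by rewrite wprod_cat wprod_rev.
  move=> _ [s /= Is <-]; exists [:: s]; rewrite ?wprod1//.
  by rewrite /= andbT.
move=> [r Ir <-] H [/= Hg IH]; elim: r Ir => [_|s r IHr /= /andP[Is Ir]].
  by rewrite wprod_nil; case: Hg => + _; rewrite inE.
rewrite wprod_cons -[gen s]invgK.
have /group_closedV HV := Hg; have HM := group_closedM Hg.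
suff : (gen s)^-1^-1 * wp r \in mem H by rewrite inE.
apply: HM; last by rewrite inE; exact: IHr.
apply: (HV); apply: (HV); rewrite inE; apply: IH; exists s => //.
Qed.

Lemma parabolic1 I : parabolic gen I 1.
Proof. by apply/parabolic_word; exists [::]; rewrite ?wprod_nil. Qed.

Lemma parabolicM I u v :
  parabolic gen I u -> parabolic gen I v -> parabolic gen I (u * v).
Proof.
move=> /parabolic_word[r Ir <-] /parabolic_word[r' Ir' <-].
apply/parabolic_word; exists (r ++ r'); last by rewrite wprod_cat.
by rewrite all_cat; apply/andP.
Qed.

Lemma parabolicV I u : parabolic gen I u -> parabolic gen I u^-1.
Proof.
move=> /parabolic_word[r Ir <-]; apply/parabolic_word; exists (rev r).
  by rewrite all_rev.
by rewrite wprod_rev.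
Qed.

Lemma parabolic_gen I s : s \in I -> parabolic gen I (gen s).
Proof.
move=> Is; apply/parabolic_word; exists [:: s]; last exact: wprod1.
by rewrite /= Is.
Qed.

Lemma parabolicS I J : I \subset J -> parabolic gen I `<=` parabolic gen J.
Proof.
move=> IJ w /parabolic_word[r /allP Ir <-]; apply/parabolic_word; exists r => //.
by apply/allP => s /Ir; apply: (fintype.subsetP IJ).
Qed.

(** The choice in [redword] never falls back on its default: [S] generates [W], so some word spells
    [w], and a shortest one is reduced. *)
Lemma redwordP w : reduced_word gen w (redword gen w).
Proof.
suff [r] : exists r, reduced_word gen w r by exact: xgetI.
have : exists n, `[< exists2 r, wp r = w & size r = n >].
  have : parabolic gen [set: S]%SET w by case: cox => _ _ ->.
  by move=> /parabolic_word[r _ <-]; exists (size r); apply/asboolP; exists r.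
move=> /ex_minnP[n /asboolP[r rw rn] min]; exists r; split=> // r' r'w.
by rewrite rn; apply: min; apply/asboolP; exists r'.
Qed.

Lemma wprod_redword w : wp (redword gen w) = w.
Proof. by case: (redwordP w). Qed.

Lemma len_wprod r : (l (wp r) <= size r)%N.
Proof. by case: (redwordP (wp r)) => _; apply. Qed.

Lemma lenV w : l w^-1 = l w.
Proof.
suff le x : (l x^-1 <= l x)%N by apply/eqP; rewrite eqn_leq le -{1}[w]invgK le.
by rewrite -{1}[x]wprod_redword -wprod_rev (leq_trans (len_wprod _)) // size_rev.
Qed.

Lemma lenM u v : (l (u * v) <= l u + l v)%N.
Proof.
rewrite -{1}[u]wprod_redword -{1}[v]wprod_redword -wprod_cat.
by rewrite (leq_trans (len_wprod _)) // size_cat.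
Qed.

Lemma len1 : l 1 = 0%N.
Proof. by apply/eqP; rewrite -leqn0 -wprod_nil; apply: len_wprod. Qed.

Lemma len_eq0 w : l w = 0%N -> w = 1.
Proof. by move=> /size0nil w0; rewrite -[w]wprod_redword w0 wprod_nil. Qed.

Lemma len_gen s : l (gen s) = 1%N.
Proof.
apply/eqP; rewrite eqn_leq -{1}wprod1 len_wprod /= lt0n.
by apply/eqP => /len_eq0/gen_neq1.
Qed.

(** * The exchange and deletion conditions *)

(** For [r = s_1 ... s_k], this is the parity of the number of [i] with
    [w = s_1 ... s_(i-1) s_i s_(i-1) ... s_1]. *)
Fixpoint reflection_parity r w : bool :=
  if r is s :: r' then (w == gen s) (+) reflection_parity r' (w ^ gen s)
  else false.

(** By [conj_ext_dihedral], sending each generator to itself paired with its indicator respects the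
    relations and extends to [W]. The parity is the boolean part of the image of [wp r]. *)
Lemma reflection_parity_wprod r r' :
  wp r = wp r' -> reflection_parity r = reflection_parity r'.
Proof.
have [_ _ _] := cox.
case/(_ (conj_ext W) (fun s => (gen s, eq_op^~ (gen s)))) => [s t n stn|phi phiE].
  by apply: conj_ext_dihedral; rewrite ?gen2.
suff phiw r1 : phi (wp r1) = (wp r1, reflection_parity r1).
  by move=> rr'; have := phiw r; rewrite rr' phiw => -[].
elim: r1 => [|s r1 IHr1]; rewrite ?wprod_nil.
  by apply: (mulgI (phi 1)); rewrite -gmulfM mulg1 [RHS]mulg1.
by rewrite !wprod_cons gmulfM phiE IHr1.
Qed.

(** An odd number of occurrences means at least one, and multiplying by the reflection on the left
    deletes the letter at which it occurs. *)
Lemma parity_exchange r w : reflection_parity r w ->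
  exists r1 s r2, r = r1 ++ s :: r2 /\ w * wp r = wp (r1 ++ r2).
Proof.
elim: r w => //= s r IHr w; case: eqP => [-> _|_ /= /IHr].
  by exists [::], s, r; rewrite wprod_cons genK.
move=> [r1 [t [r2 [rE wE]]]]; exists (s :: r1), t, r2; split; first by rewrite rE.
by rewrite !wprod_cons -wE mulgA (conjgC w) -mulgA.
Qed.

(** If [gen s] does not have odd parity in [r], it has odd parity in [s :: r], hence in a reduced
    word of [gen s * wp r]. Deleting a letter there spells [wp r] by a word shorter than the length
    hypothesis allows. *)
Lemma exchange s r : (l (gen s * wp r) <= l (wp r))%N ->
  exists r1 t r2, r = r1 ++ t :: r2 /\ gen s * wp r = wp (r1 ++ r2).
Proof.
case: (boolP (reflection_parity r (gen s))) => [/parity_exchange ex _|Ns le].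
  exact: ex.
pose r' := redword gen (gen s * wp r).
have : reflection_parity r' (gen s).
  rewrite (@reflection_parity_wprod _ (s :: r)) ?wprod_redword ?wprod_cons//=.
  by rewrite eqxx conjgE mulKg.
case/parity_exchange => r1 [t [r2 [r'E wE]]].
move: le; rewrite {1}/len -/r' r'E; move: wE; rewrite wprod_redword genK => ->.
by move=> /leq_trans/(_ (len_wprod _)); rewrite !size_cat addnS ltnn.
Qed.

Definition reduced r := l (wp r) == size r.

Lemma reduced_redword w : reduced (redword gen w).
Proof. by rewrite /reduced wprod_redword. Qed.

Lemma reduced_catP r r' : reduced (r ++ r') -> reduced r /\ reduced r'.
Proof.
rewrite /reduced wprod_cat size_cat => /eqP rr'.
have := lenM (wp r) (wp r'); have := len_wprod r; have := len_wprod r'.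
by rewrite rr' !eqn_leq => le' le leM; split; apply/andP; split; lia.
Qed.

(** This is the deletion condition: each letter put in front of a reduced word either lengthens the
    product or cancels against a later letter by exchange. *)
Lemma reduced_subseq r : exists r', [/\ subseq r' r, wp r' = wp r & reduced r'].
Proof.
elim: r => [|s r [r' [sub wE /eqP red]]].
  by exists [::]; rewrite /reduced wprod_nil len1.
have [le|lt] := leqP (l (gen s * wp r')) (l (wp r')).
  have [r1 [t [r2 [r'E sE]]]] := exchange le.
  exists (r1 ++ r2); split.
  - apply: (subseq_trans _ (subseq_cons _ _)); apply: subseq_trans sub.
    by rewrite r'E cat_subseq // subseq_cons.
  - by rewrite -sE wE wprod_cons.
  (* The word [r1 ++ r2] has one letter less than the reduced [r'], and a generator lowers the
     length by at most one. *)
  rewrite /reduced -sE eqn_leq; apply/andP; split.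
    by rewrite sE len_wprod.
  have := lenM (gen s) (gen s * wp r'); rewrite genK red r'E len_gen !size_cat /=.
  by lia.
exists (s :: r'); split; rewrite /= ?eqxx//; first by rewrite !wprod_cons wE.
rewrite /reduced eqn_leq len_wprod /=; move: lt; rewrite red wprod_cons //.
Qed.

Lemma parabolic_reduced I w : parabolic gen I w ->
  exists r, [/\ word_in I r, wp r = w & reduced r].
Proof.
move=> /parabolic_word[r Ir <-]; have [r' [sub wE red]] := reduced_subseq r.
by exists r'; split=> //; apply/allP => s /(mem_subseq sub)/(allP Ir).
Qed.

(** * Minimal double coset representatives *)

Lemma mindcoset_le I J w x :
  mindcoset gen I J w -> dcoset gen I J w x -> (l w <= l x)%N.
Proof. by move=> min /min; have [->//|/eqP xw /(_ xw)/ltnW] := eqVneq x w. Qed.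

(* Deleting letters from a word for [u * w * v] never touches the part spelling
   [w], as [w] is shortest in its double coset. *)
Lemma dcoset_reduce I J w u v :
    (forall x, dcoset gen I J w x -> (l w <= l x)%N) ->
    parabolic gen I u -> parabolic gen J v ->
  exists a b, [/\ parabolic gen I a, parabolic gen J b,
    u * w * v = a * w * b, l (u * w * v) = (l a + l w + l b)%N &
    (v = 1 -> b = 1) /\ (u = 1 -> a = 1)].
Proof.
move=> min Pu Pv.
have [ru [Iu uE redu]] := parabolic_reduced Pu.
have [rv [Jv vE redv]] := parabolic_reduced Pv.
pose rw := redword gen w.
have [r [/subseq_cat_split[r1 [r' [-> sub1 sub']]] wE]] :=
  reduced_subseq (ru ++ rw ++ rv).
move: sub' wE => /subseq_cat_split[r2 [r3 [-> sub2 sub3]]] wE.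
move=> /[dup] /reduced_catP[/eqP red1 /reduced_catP[/eqP red2 /eqP red3]] /eqP red.
have P1 : parabolic gen I (wp r1).
  apply/parabolic_word; exists r1 => //.
  by apply/allP => s /(mem_subseq sub1)/(allP Iu).
have P3 : parabolic gen J (wp r3).
  apply/parabolic_word; exists r3 => //.
  by apply/allP => s /(mem_subseq sub3)/(allP Jv).
rewrite !wprod_cat uE vE /rw wprod_redword in wE.
(* The product of [r2] lies in the double coset of [w], so [r2] is at least as long as [rw], of
   which it is a subsequence. *)
have r2E : r2 = rw.
  apply/eqP; rewrite -(size_subseq_leqif sub2).2 eqn_leq (size_subseq_leqif sub2).
  rewrite -red2; apply: min; exists ((wp r1)^-1 * u).
    exact: parabolicM (parabolicV P1) Pu.
  exists (v * (wp r3)^-1); first exact: parabolicM Pv (parabolicV P3).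
  have -> : wp r2 = (wp r1)^-1 * (wp r1 * (wp r2 * wp r3)) * (wp r3)^-1.
    by rewrite mulKg mulgK.
  by rewrite wE -!mulgA.
have wordn1 (r0 r4 : seq S) :
    subseq r0 r4 -> reduced r4 -> wp r4 = 1 -> wp r0 = 1.
  move=> sub /eqP + r41; rewrite r41 len1 => /esym/size0nil r40.
  by move: sub; rewrite r40 subseq0 => /eqP ->; rewrite wprod_nil.
exists (wp r1), (wp r3); split=> //.
- by rewrite -mulgA -wE r2E wprod_redword mulgA.
- by rewrite -mulgA -wE -!wprod_cat red red1 red3 !size_cat r2E addnA.
by split=> [v1|u1]; [apply: wordn1 sub3 _ _|apply: wordn1 sub1 _ _];
  rewrite ?vE ?uE.
Qed.

(** A shortest element [x] exists. It is strictly shortest because any other element is [a * x * b]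
    with lengths adding up, so equal length forces [a = b = 1]. *)
Lemma exists_mindcoset I J w : exists2 x, dcoset gen I J w x & mindcoset gen I J x.
Proof.
have : exists n, `[< exists2 x, dcoset gen I J w x & l x = n >].
  exists (l w); apply/asboolP; exists w => //.
  exists 1; [exact: parabolic1|exists 1; [exact: parabolic1|]].
  by rewrite mul1g mulg1.
move=> /ex_minnP[n /asboolP[x dx <-] min]; exists x => // y.
have dcoset_trans z : dcoset gen I J x z -> dcoset gen I J w z.
  case: dx => u Iu [v Jv <-] [u' Iu' [v' Jv' <-]].
  exists (u' * u); first exact: parabolicM.
  by exists (v * v'); [exact: parabolicM|rewrite !mulgA].
have le z : dcoset gen I J x z -> (l x <= l z)%N.
  by move=> /dcoset_trans dz; apply: min; apply/asboolP; exists z.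
case=> u Iu [v Jv <-].
have [a [b [Pa Pb -> -> _]]] := dcoset_reduce le Iu Jv.
have [/len_eq0->|] := eqVneq (l a) 0%N; have [/len_eq0->|] := eqVneq (l b) 0%N.
- by rewrite mul1g mulg1.
- by lia.
- by lia.
- by lia.
Qed.

(** With trivial right factor, [dcoset_reduce] gives [u * w = a * w] with lengths adding up, and
    [a = u] by cancellation. *)
Lemma mindcoset_lenl I J w u : mindcoset gen I J w -> parabolic gen I u ->
  l (u * w) = (l u + l w)%N.
Proof.
move=> /mindcoset_le min Pu.
have [a [b [_ _ E lE [b1 _]]]] := dcoset_reduce (min) Pu (@parabolic1 J).
by move: E lE; rewrite b1// !mulg1 len1 addn0 => /mulIg <-.
Qed.

Lemma mindcosetV I J w : mindcoset gen I J w -> mindcoset gen J I w^-1.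
Proof.
move=> min _ [u Iu [v Jv <-]] ne; rewrite lenV -[X in (_ < X)%N]lenV; apply: min.
  exists v^-1; first exact: parabolicV.
  by exists u^-1; [exact: parabolicV|rewrite !invgM invgK mulgA].
by move=> E; apply: ne; rewrite -[LHS]invgK E.
Qed.

Lemma mindcoset_lenr I J w v : mindcoset gen I J w -> parabolic gen J v ->
  l (w * v) = (l w + l v)%N.
Proof.
move=> /mindcosetV min Jv; rewrite -lenV invgM (mindcoset_lenl min).
  by rewrite !lenV addnC.
exact: parabolicV.
Qed.

Lemma parabolic_len1 I u : parabolic gen I u -> l u = 1%N ->
  exists2 s, s \in I & u = gen s.
Proof.
move=> /parabolic_reduced[[|s [|? ?]] [Ir <- /eqP ->]]// _.
by exists s; [move: Ir; rewrite /= andbT|rewrite wprod1].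
Qed.

(** Lengths add on both sides of the equation, so [v] has length 1 and is a generator from [J]. *)
Lemma mindcoset_conj_gen I J w s v : mindcoset gen I J w -> s \in I ->
  parabolic gen J v -> gen s * w = w * v -> s \in capconj gen I w J.
Proof.
move=> min Is Jv E.
have lv : l v = 1%N.
  apply/eqP; rewrite -(eqn_add2l (l w)) -(mindcoset_lenr min Jv) -E.
  by rewrite (mindcoset_lenl min (parabolic_gen Is)) len_gen addnC.
have [t Jt vE] := parabolic_len1 Jv lv.
rewrite inE Is; apply/exists_inP; exists t => //.
by rewrite -vE -E mulgK.
Qed.

(* Kilmoyer's lemma *)
Lemma parabolic_capconj I J w u v : mindcoset gen I J w ->
    parabolic gen I u -> parabolic gen J v -> u * w = w * v ->
  parabolic gen (capconj gen I w J) u.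
Proof.
move=> min /parabolic_reduced[r [+ <- +]].
elim: r v => [*|s r IHr v /andP[Is Ir] red].
  by rewrite wprod_nil; apply: parabolic1.
move=> /[dup] Jv /parabolic_reduced[c [Jc vE _]] E.
have /eqP redr : reduced r by have [] := @reduced_catP [:: s] r red.
have Pr : parabolic gen I (wp r) by apply/parabolic_word; exists r.
(* The word [redword gen w ++ c] spells [w * v = u * w], which is shortened by the first letter [s]
   of [u]. *)
have /exchange[r1 [t [r2 [wcE sE]]]] :
    (l (gen s * wp (redword gen w ++ c)) <= l (wp (redword gen w ++ c)))%N.
  rewrite wprod_cat wprod_redword vE -E wprod_cons -mulgA genK.
  rewrite (mindcoset_lenl min Pr) mulgA -wprod_cons (mindcoset_lenl min).
    by rewrite (eqP red) redr leq_add2r /=.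
  by rewrite wprod_cons; exact: parabolicM (parabolic_gen Is) Pr.
(* A letter deleted inside [w] would make [gen s * w] shorter than [w], against the minimality of
   [w]. *)
case: (cat_cons_split wcE) sE => [[b2 wE ->]|[c1 cE ->]].
  rewrite catA !wprod_cat wprod_redword mulgA => /mulIg/(congr1 l).
  rewrite (mindcoset_lenl min (parabolic_gen Is)) len_gen -wprod_cat => lE.
  have := len_wprod (r1 ++ b2); rewrite -lE /len wE !size_cat /=.
  by rewrite addnS add1n ltnNge leqnSn.
(* A letter deleted inside [c] gives [gen s * (w * v) = w * v'] with [v'] in [W_J]. Hence [gen s] is
   conjugate into [W_J], and [wp r * w = w * v'] feeds the induction. *)
rewrite wprod_cat wprod_redword vE -catA wprod_cat wprod_redword => sE.
have Jv' : parabolic gen J (wp (c1 ++ r2)).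
  apply/parabolic_word; exists (c1 ++ r2) => //.
  by move: Jc; rewrite cE !all_cat /= => /and3P[-> _ ->].
rewrite wprod_cons; apply: parabolicM.
  apply: parabolic_gen; apply: (mindcoset_conj_gen min Is).
    exact: parabolicM Jv' (parabolicV Jv).
  by rewrite mulgA -sE mulgA mulgK.
apply: IHr Jv' _ => //; first by rewrite /reduced redr.
by rewrite -sE -E wprod_cons -mulgA genK.
Qed.

(** The easy inclusion complementing Kilmoyer's lemma: letters of [I] are conjugated into [J] one at
    a time. *)
Lemma capconjP I J w u : parabolic gen (capconj gen I w J) u ->
  parabolic gen I u /\ exists2 v, parabolic gen J v & u * w = w * v.
Proof.
move=> /parabolic_word[r Kr <-]; elim: r Kr => [_|s r IHr /= /andP[Ks /IHr]].
  rewrite wprod_nil; split; first exact: parabolic1.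
  by exists 1; [exact: parabolic1|rewrite mul1g mulg1].
move: Ks; rewrite inE => /andP[Is /exists_inP[t Jt /eqP sE]] [Ir [v Jv E]].
rewrite wprod_cons; split; first exact: parabolicM (parabolic_gen Is) Ir.
exists (gen t * v); first exact: parabolicM (parabolic_gen Jt) Jv.
by rewrite -mulgA E sE !mulgA mulgVK.
Qed.

End CoxeterGroups.

(** * Counting *)

Section Counting.
Local Open Scope nat_scope.

Lemma card_setU_disjoint (T : choiceType) (A B : set T) m n :
  A #= `I_m -> B #= `I_n -> A `&` B = set0 -> A `|` B #= `I_(m + n).
Proof.
move=> Am Bn AB0.
have fA : finite_set A by exists m.
have fB : finite_set B by exists n.
have fAB : finite_set (A `|` B) by rewrite finite_setU.
rewrite -[A `|` B]fset_setK //; apply/card_eq_fsetP.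
rewrite fset_setU // cardfsU -fset_setI // AB0 fset_set0 cardfs0 subn0.
by rewrite (card_fset_set Am) (card_fset_set Bn).
Qed.

Section Fibration.
Variables (T U : choiceType) (X : set T) (Y : set U) (R : T -> U -> Prop).
Variable m : U -> nat.
Hypothesis totalR : forall x, X x -> exists2 y, Y y & R x y.
Hypothesis functionalR :
  forall x y z, X x -> Y y -> Y z -> R x y -> R x z -> y = z.
Hypothesis card_fiber : forall y, Y y -> [set x | X x /\ R x y] #= `I_(m y).

(** [X] is the disjoint union of its fibres over [Y]; the induction adds one fibre at a time along
    an enumeration of [Y]. *)
Lemma card_fibration : finite_set Y -> X #= `I_(\big[addn/0]_(y \in Y) m y).
Proof.
move=> fY; rewrite fsbig_finite //=.
have : {subset enum_fset (fset_set Y) <= Y}.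
  by move=> y yY; rewrite -in_fset_set.
have -> : X = [set x | X x /\ exists2 y, y \in (fset_set Y : seq U) & R x y].
  apply/seteqP; split=> x; last by case.
  move=> Xx; split=> //; have [y Yy Rxy] := totalR Xx; exists y => //.
  by rewrite in_fset_set // inE.
elim: (fset_set Y : seq U) (fset_uniq (fset_set Y)) =>
  [_ _|y s IHs /andP[ys us] sY].
  rewrite big_nil II0 card_eq0.
  by apply/eqP/seteqP; split=> // x [_ []].
have Yy : Y y by have := sY y (mem_head y s); rewrite inE.
have sY' : {subset s <= Y} by move=> z zs; apply: sY; rewrite in_cons zs orbT.
rewrite big_cons.
have -> : [set x | X x /\ exists2 z, z \in y :: s & R x z] =
    [set x | X x /\ R x y] `|` [set x | X x /\ exists2 z, z \in s & R x z].
  apply/seteqP; split=> x.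
    move=> [Xx [z]]; rewrite in_cons => /orP[/eqP->|zs] Rxz; first by left.
    by right; split=> //; exists z.
  move=> [[Xx Rxy]|[Xx [z zs Rxz]]]; split=> //.
    by exists y => //; rewrite mem_head.
  by exists z => //; rewrite in_cons zs orbT.
apply: (card_setU_disjoint (card_fiber Yy) (IHs us sY')).
apply/seteqP; split=> // x [[Xx Rxy] [_ [z zs Rxz]]].
move: ys; rewrite (functionalR Xx Yy _ Rxy Rxz) ?zs //.
by have := sY' z zs; rewrite inE.
Qed.

End Fibration.

Lemma card_fibration_cst (T U : choiceType) (X : set T) (Y : set U)
    (R : T -> U -> Prop) m n :
    (forall x, X x -> exists2 y, Y y & R x y) ->
    (forall x y z, X x -> Y y -> Y z -> R x y -> R x z -> y = z) ->
    (forall y, Y y -> [set x | X x /\ R x y] #= `I_m) ->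
  Y #= `I_n -> X #= `I_(n * m).
Proof.
move=> total functional fiber Yn; have fY : finite_set Y by exists n.
have := card_fibration (m := fun=> m) total functional fiber fY.
rewrite fsbig_finite //= big_const_seq iter_addn_0 count_predT.
by rewrite (card_fset_set Yn) mulnC.
Qed.

Lemma card_image_inj (T U : Type) (A : set T) (B : set U) (f : T -> U) n :
    (forall x, A x -> B (f x)) -> (forall y, B y -> exists2 x, A x & f x = y) ->
    (forall x y, A x -> A y -> f x = f y -> x = y) ->
  A #= `I_n <-> B #= `I_n.
Proof.
move=> fAB fBA inj; have <- : f @` A = B.
  apply/seteqP; split=> [y [x Ax <-]|y /fBA[x Ax <-]]; first exact: fAB.
  by exists x.
have /card_eql -> // : f @` A #= A.
by apply: inj_card_eq => x y; rewrite !inE; apply: inj.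
Qed.

End Counting.

(** * Buildings *)

Section Buildings.
Local Open Scope group_scope.
Variables (W : groupType) (S : finType) (gen : S -> W) (X : typed_complex S).
Variable delta : set (vertex X) -> set (vertex X) -> W.
Hypothesis cox : coxeter_system gen.
Hypothesis bld : building gen delta.
Implicit Types (s t : S) (r : seq S) (u v w x : W) (I J K : {set S}).
Implicit Types A B C D E F : set (vertex X).

Local Notation wp := (wprod gen).
Local Notation l := (len gen).
Local Notation ch := (@chambers S X).

(** * Adjacency and galleries *)

Lemma delta1 C D : ch C -> ch D -> delta C D = 1 <-> C = D.
Proof. by case: bld => _ + _ _ _; apply. Qed.

(** The third building axiom is applied with [C'] also as the target chamber, where the distance is
    1. *)
Lemma delta_gen_sym C C' s : ch C -> ch C' ->
  delta C' C = gen s -> delta C C' = gen s.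
Proof.
move=> cC cC' C'C; case: bld => _ _ /(_ C C' C' s cC cC' cC' C'C)[+ _] _ _.
have -> : delta C' C' = 1 by apply/delta1.
case=> [/esym sE|/esym/delta1 CC'].
  by rewrite -[LHS](genK cox s) sE mulg1.
by rewrite CC' // in C'C *.
Qed.

Lemma delta_step C C' D s : ch C -> ch C' -> ch D -> delta C C' = gen s ->
  delta C D = gen s * delta C' D \/ delta C D = delta C' D.
Proof. by move=> cC cC' cD CC'; case: bld => _ _ /(_ C' D C s)[]. Qed.

Lemma delta_step_up C C' D s : ch C -> ch C' -> ch D -> delta C C' = gen s ->
  l (gen s * delta C' D) = (l (delta C' D)).+1 -> delta C D = gen s * delta C' D.
Proof. by move=> cC cC' cD CC'; case: bld => _ _ /(_ C' D C s)[]. Qed.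

Lemma delta_move C D s : ch C -> ch D ->
  exists C', [/\ ch C', delta C C' = gen s & delta C' D = gen s * delta C D].
Proof.
move=> cC cD; case: bld => _ _ _ /(_ C D s cC cD)[C' [cC' C'C C'D]] _.
by exists C'; split=> //; apply: delta_gen_sym.
Qed.

Lemma delta_step_trans C C' D s : ch C -> ch C' -> ch D ->
  delta C C' = gen s -> delta C' D = gen s -> delta C D = gen s \/ C = D.
Proof.
move=> cC cC' cD CC' C'D; case: (delta_step cC cC' cD CC') => E.
  by right; apply/delta1; rewrite // E C'D (gen2 cox).
by left; rewrite E.
Qed.

Fixpoint gallery C r D : Prop :=
  if r is s :: r' then
    exists C', [/\ ch C', delta C C' = gen s & gallery C' r' D]
  else C = D.

Lemma gallery_chamber C r D : gallery C r D -> ch C -> ch D.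
Proof. by elim: r C => [C <-//|s r IHr C [C' [cC' _ /IHr]] /= +_]; apply. Qed.

Lemma gallery_cat C r r' D :
  gallery C (r ++ r') D <-> exists2 E, gallery C r E & gallery E r' D.
Proof.
elim: r C => [|s r IHr] C /=.
  by split=> [CD|[E -> //]]; exists C.
split=> [[C' [cC' CC' /IHr[E C'E ED]]]|[E [C' [cC' CC' C'E]] ED]].
  by exists E => //; exists C'.
by exists C'; split=> //; apply/IHr; exists E.
Qed.

Lemma gallery_rev C r D : ch C -> gallery C r D -> gallery D (rev r) C.
Proof.
elim: r C => [//|s r IHr] C cC /= [C' [cC' CC' C'D]].
rewrite rev_cons -cats1; apply/gallery_cat; exists C'; first exact: IHr.
by exists C; split=> //; apply: delta_gen_sym.
Qed.

(** The fourth building axiom realises the letters in turn, so [r] need not be reduced. *)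
Lemma delta_gallery C r D : ch C -> ch D -> delta C D = wp r -> gallery C r D.
Proof.
elim: r C => [|s r IHr] C cC cD.
  by rewrite wprod_nil => /delta1 ->.
rewrite wprod_cons => CD; have [C' [cC' CC' C'D]] := delta_move s cC cD.
by exists C'; split=> //; apply: IHr => //; rewrite C'D CD genK.
Qed.

(** Along a reduced word every step lengthens the distance to [D], and then the third axiom
    determines it. *)
Lemma gallery_delta C r D :
  ch C -> reduced gen r -> gallery C r D -> delta C D = wp r.
Proof.
elim: r C => [|s r IHr] C cC red /=.
  by move=> <-; rewrite wprod_nil; apply/delta1.
move=> [C' [cC' CC' C'D]]; have [_ red'] := @reduced_catP _ _ _ cox [:: s] r red.
have C'DE := IHr C' cC' red' C'D; have cD := gallery_chamber C'D cC'.
rewrite wprod_cons -C'DE; apply: delta_step_up => //.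
by rewrite C'DE -wprod_cons (eqP red) (eqP red').
Qed.

Lemma deltaV C D : ch C -> ch D -> delta D C = (delta C D)^-1.
Proof.
move=> cC cD; pose r := redword gen (delta C D).
have rE : wp r = delta C D by exact: wprod_redword.
rewrite -rE -(wprod_rev cox); apply: gallery_delta => //.
  by rewrite /reduced wprod_rev // lenV // size_rev; exact: reduced_redword.
by apply: gallery_rev => //; apply: delta_gallery.
Qed.

Lemma delta_cat C D E : ch C -> ch D -> ch E ->
    l (delta C D * delta D E) = (l (delta C D) + l (delta D E))%N ->
  delta C E = delta C D * delta D E.
Proof.
move=> cC cD cE lE.
pose r := redword gen (delta C D); pose r' := redword gen (delta D E).
have rE : wp (r ++ r') = delta C D * delta D E by rewrite wprod_cat !wprod_redword.
rewrite -rE; apply: gallery_delta => //.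
  by rewrite /reduced rE lE size_cat.
by apply/gallery_cat; exists D; apply: delta_gallery; rewrite ?wprod_redword.
Qed.

Lemma delta_split C E u v : ch C -> ch E -> l (u * v) = (l u + l v)%N ->
  delta C E = u * v -> exists D, [/\ ch D, delta C D = u & delta D E = v].
Proof.
move=> cC cE lE CE.
have /gallery_cat[] : gallery C (redword gen u ++ redword gen v) E.
  by apply: delta_gallery; rewrite // wprod_cat !wprod_redword.
move=> D CD DE; have cD := gallery_chamber CD cC; exists D; split=> //.
  by rewrite -[RHS](wprod_redword cox); apply: gallery_delta; rewrite ?reduced_redword.
by rewrite -[RHS](wprod_redword cox); apply: gallery_delta; rewrite ?reduced_redword.
Qed.

(** The walk from [D] follows a reduced word of [u] from its last letter. Each step is chosen to
    multiply the distance to [E] by its letter, while the distance to [D] is forced because lengths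
    grow; nothing is assumed on the length of [u * delta D E]. *)
Lemma delta_extend D E u : ch D -> ch E ->
  exists C, [/\ ch C, delta C D = u & delta C E = u * delta D E].
Proof.
move=> cD cE; rewrite -[u](wprod_redword cox).
elim: (redword gen u) (reduced_redword cox u) => [_|s r IHr red].
  by exists D; rewrite wprod_nil mul1g; split=> //; apply/delta1.
have [_ red'] := @reduced_catP _ _ _ cox [:: s] r red.
have [C [cC CD CE]] := IHr red'; have [C' [cC' CC' C'E]] := delta_move s cC cE.
exists C'; rewrite wprod_cons -mulgA -CE -CD; split=> //.
apply: delta_step_up => //; first exact: delta_gen_sym.
by rewrite CD -wprod_cons (eqP red) (eqP red').
Qed.

(** Along a gallery with letters in [I], each step multiplies the distance to [D] by its letter or
    leaves it unchanged. *)
Lemma delta_left I C C' D :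
  ch C -> ch C' -> ch D -> parabolic gen I (delta C' C) ->
  exists2 u, parabolic gen I u & delta C' D = u * delta C D.
Proof.
move=> cC cC' cD /(parabolic_word cox)[r Ir /esym rE].
elim: r C' cC' Ir rE => [|s r IHr] C' cC' Ir rE.
  exists 1; first exact: parabolic1.
  by move: rE; rewrite wprod_nil mul1g => /delta1 -> //.
have [Is Ir'] := andP Ir; have [C1 [cC1 C'C1 C1C]] := delta_move s cC' cC.
have [|u Iu C1D] := IHr C1 cC1 Ir'; first by rewrite C1C rE wprod_cons genK.
case: (delta_step cC' cC1 cD C'C1) => ->; rewrite C1D; last by exists u.
by exists (gen s * u); [apply: parabolicM => //; exact: parabolic_gen|rewrite mulgA].
Qed.

Lemma delta_right J C D D' :
  ch C -> ch D -> ch D' -> parabolic gen J (delta D D') ->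
  exists2 v, parabolic gen J v & delta C D' = delta C D * v.
Proof.
move=> cC cD cD' Jv; have [|v Jv' E] := @delta_left J D D' C cD cD' cC.
  by rewrite deltaV //; apply: parabolicV.
exists v^-1; first exact: parabolicV.
by rewrite (deltaV cD' cC) E invgM -deltaV.
Qed.

(** * Spheres, faces and residues *)

Definition wsphere C v : set (set (vertex X)) := [set D | ch D /\ delta C D = v].

Definition face J C : set (vertex X) := [set x | C x /\ vtype x \notin J].

Lemma mem_stype s A : (s \in stype A) <-> exists2 x, A x & vtype x = s.
Proof. by rewrite inE; split=> /asboolP. Qed.

Lemma chamber_vertex C s : ch C -> exists2 x, C x & vtype x = s.
Proof.
move=> [_ C0]; apply/mem_stype; apply: contraT.
by have /setP/(_ s) := C0; rewrite !inE => ->.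
Qed.

Lemma sub_face I C A : simplices I A -> A `<=` C -> A `<=` face I C.
Proof.
move=> [sA <-] sAC x Ax; split; first exact: sAC.
by rewrite finset.in_setC negbK; apply/mem_stype; exists x.
Qed.

Lemma face_simplices J C : ch C -> simplices J (face J C).
Proof.
move=> cC; split; first by apply: (simplex_face cC.1) => x [].
apply/setP => s; rewrite finset.in_setC; apply/idP/idP; last first.
  move=> Js; apply/negP => /mem_stype[x [_ +] xs].
  by rewrite xs Js.
apply: contraNT => Js; apply/mem_stype; have [x Cx xs] := chamber_vertex s cC.
by exists x => //; split=> //; rewrite xs.
Qed.

(** Vertices of [C] of equal type coincide, so a face is determined by its type. *)
Lemma face_unique J C B : ch C -> simplices J B -> B `<=` C -> B = face J C.
Proof.
move=> cC sB BC; apply/seteqP; split; first exact: sub_face.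
move=> x [Cx]; rewrite -sB.2 finset.in_setC negbK => /mem_stype[y By yx].
by rewrite -(simplex_vtype cC.1 (BC _ By) Cx yx).
Qed.

Lemma chambers_at_neq0 I A : simplices I A -> exists C, chambers_at A C.
Proof.
move=> [sA _]; have [C [sC sAC Ct]] := simplex_chamber sA.
exists C; split=> //; split=> //; apply/setP => s; rewrite !inE.
by apply/negbTE; rewrite negbK; apply/asboolP.
Qed.

Lemma chambers_at_residue I A C : simplices I A -> chambers_at A C ->
  forall D, chambers_at A D <-> ch D /\ parabolic gen I (delta C D).
Proof.
move=> sA sAC D; case: bld => _ _ _ _ /(_ I A C sA sAC) E.
by rewrite [chambers_at A]E.
Qed.

End Buildings.

(** * Cardinalities of spheres and residues of chambers *)

Section Counts.
Local Open Scope group_scope.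
Variables (W : groupType) (S : finType) (gen : S -> W) (X : typed_complex S).
Variable delta : set (vertex X) -> set (vertex X) -> W.
Variable q : S -> nat.
Hypothesis cox : coxeter_system gen.
Hypothesis bld : building gen delta.
Hypothesis reg : regular X q.
Implicit Types (s t : S) (r : seq S) (u v w x : W) (I J K : {set S}).
Implicit Types A B C D E F : set (vertex X).

Local Notation wp := (wprod gen).
Local Notation l := (len gen).
Local Notation ch := (@chambers S X).

Lemma parabolic_set1 s x : parabolic gen [set s]%SET x -> x = 1 \/ x = gen s.
Proof.
move=> /(parabolic_word cox)[r + <-]; elim: r => [_|t r IHr /= /andP[+ /IHr]].
  by left; rewrite wprod_nil.
rewrite wprod_cons finset.in_set1 => /eqP -> [] ->; last by left; rewrite (gen2 cox).
by right; rewrite mulg1.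
Qed.

(** The panel of [C] of cotype [s] lies on [C] itself and on the chambers of this sphere, so one is
    subtracted from [q s + 1]. *)
Lemma card_wsphere_gen C s : ch C -> wsphere delta C (gen s) #= `I_(q s).
Proof.
move=> cC; have sP := face_simplices [set s]%SET cC; set P := face _ _ in sP.
have PC : chambers_at P C by split=> // x [].
have PE : chambers_at P = [set C] `|` wsphere delta C (gen s).
  apply/seteqP; split=> D.
    move=> /(chambers_at_residue bld sP PC)[cD /parabolic_set1[/(delta1 bld) ->//|CD]].
      by left.
    by right.
  move=> [->//|[cD CD]]; apply/(chambers_at_residue bld sP PC); split=> //.
  by rewrite CD; apply: (parabolic_gen cox); rewrite finset.in_set1.
have cardP := (reg s).2 P sP.
have [n cardn] : finite_set (wsphere delta C (gen s)).
  apply: (@sub_finite_set _ _ (chambers_at P)); first by rewrite PE => D; right.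
  by exists (q s).+1.
have : chambers_at P #= `I_(1 + n).
  rewrite PE; apply: card_setU_disjoint card_set1 cardn _.
  apply/seteqP; split=> // D [-> [_ CC]]; case: (gen_neq1 cox (s := s)).
  by rewrite -CC; apply/(delta1 bld).
move=> /card_esym/card_eq_trans/(_ cardP)/card_eq_II/eqP.
by rewrite add1n eqSS => /eqP <-.
Qed.

(** A chamber [D] of the sphere is sent to the second chamber of the gallery of reduced type [r]
    from [C] to [D]. *)
Lemma card_wsphere_word C r : ch C -> reduced gen r ->
  wsphere delta C (wp r) #= `I_(\prod_(s <- r) q s).
Proof.
elim: r C => [|s r IHr] C cC red.
  rewrite big_nil wprod_nil; have -> : wsphere delta C 1 = [set C].
    apply/seteqP; split=> [D [cD /(delta1 bld) ->//]|_ ->].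
    by split=> //; apply/(delta1 bld).
  exact: card_set1.
have [_ red'] := @reduced_catP _ _ _ cox [:: s] r red.
have ls : l (gen s * wp r) = (l (wp r)).+1.
  by rewrite -wprod_cons (eqP red) (eqP red').
rewrite big_cons wprod_cons.
apply: (@card_fibration_cst _ _ _ (wsphere delta C (gen s))
  (fun D C' => delta C' D = wp r)) (card_wsphere_gen s cC).
- move=> D [cD CD]; have [|C' [cC' CC' C'D]] := delta_split cox bld cC cD _ CD.
    by rewrite ls (len_gen cox).
  by exists C'.
(* Two distinct candidates would be [s]-adjacent, and a step from one to the other would lengthen
   the distance to [D]. *)
- move=> D C1 C2 [cD CD] [cC1 CC1] [cC2 CC2] C1D C2D.
  have C1C : delta C1 C = gen s by apply: (delta_gen_sym cox bld).
  have [C12|//] := delta_step_trans cox bld cC1 cC cC2 C1C CC2.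
  have := delta_step_up bld cC1 cC2 cD C12; rewrite C2D => /(_ ls).
  by rewrite C1D => E; move: ls; rewrite -E => /eqP; rewrite ltn_eqF.
- move=> C' [cC' CC']; have -> : [set D | wsphere delta C (gen s * wp r) D /\
      delta C' D = wp r] = wsphere delta C' (wp r); last exact: IHr.
  apply/seteqP; split=> D [] => [[cD _]|cD] C'D //; split=> //; split=> //.
  by rewrite -C'D; apply: (delta_step_up bld) => //; rewrite C'D.
Qed.

Lemma card_wsphere C v : ch C -> wsphere delta C v #= `I_(qprod gen q v).
Proof.
move=> cC; rewrite -{1}[v](wprod_redword cox).
by apply: card_wsphere_word; rewrite ?reduced_redword.
Qed.

Lemma card_residue C K : ch C -> spherical gen K ->
  [set D | ch D /\ parabolic gen K (delta C D)] #= `I_(qsum gen q K).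
Proof.
move=> cC sphK.
apply: (@card_fibration _ _ _ (parabolic gen K) (fun D v => delta C D = v)) => //.
- by move=> D [cD KD]; exists (delta C D).
- by move=> D u v _ _ _ <-.
- move=> v Kv; have -> : [set D | (ch D /\ parabolic gen K (delta C D)) /\
      delta C D = v] = wsphere delta C v; last exact: card_wsphere.
  apply/seteqP; split=> D [] => [[cD _]|cD] CD //; split=> //.
  by split=> //; rewrite CD.
Qed.

(** The residue counted by [qsum gen q K] contains its base chamber. *)
Lemma qsum_gt0 K : spherical gen K -> (0 < qsum gen q K)%N.
Proof.
move=> sphK; rewrite lt0n; apply/eqP => q0.
have [C cC] : exists C, ch C by case: bld.
have := card_residue cC sphK; rewrite q0 II0 card_eq0 => /eqP E.
suff : [set D | ch D /\ parabolic gen K (delta C D)] C by rewrite E.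
split=> //; have -> : delta C C = 1 by apply/(delta1 bld).
exact: parabolic1.
Qed.

(** * The Weyl distance between simplices *)

Lemma delta_dcoset I J A B C D C' D' : simplices I A -> simplices J B ->
    chambers_at A C -> chambers_at A C' -> chambers_at B D -> chambers_at B D' ->
  dcoset gen I J (delta C D) (delta C' D').
Proof.
move=> sA sB CA CA' DB DB'.
have [|u Iu uE] := @delta_left _ _ _ _ _ cox bld I C C' D CA.1 CA'.1 DB.1.
  by have [] := (chambers_at_residue bld sA CA' C).1 CA.
have [|v Jv vE] := @delta_right _ _ _ _ _ cox bld J C' D D' CA'.1 DB.1 DB'.1.
  by have [] := (chambers_at_residue bld sB DB D').1 DB'.
by exists u => //; exists v => //; rewrite vE uE.
Qed.

(** The left factor is realised by moving [C] inside its residue, then the right factor by moving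
    [D], with distances inverted. *)
Lemma dcoset_delta I J A B C D x : simplices I A -> simplices J B ->
    chambers_at A C -> chambers_at B D -> dcoset gen I J (delta C D) x ->
  exists C' D', [/\ chambers_at A C', chambers_at B D' & delta C' D' = x].
Proof.
move=> sA sB CA DB [u Iu [v Jv <-]].
have [C' [cC' C'C C'D]] := delta_extend cox bld u CA.1 DB.1.
have [D' [cD' D'D D'C']] := delta_extend cox bld v^-1 DB.1 cC'.
exists C', D'; split.
- apply/(chambers_at_residue bld sA CA); split=> //.
  by rewrite (deltaV cox bld cC' CA.1) C'C; apply: parabolicV.
- apply/(chambers_at_residue bld sB DB); split=> //.
  by rewrite (deltaV cox bld cD' DB.1) D'D invgK.
- rewrite (deltaV cox bld cD' cC') D'C' (deltaV cox bld cC' DB.1) C'D.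
  by rewrite invgM !invgK.
Qed.

Lemma gsphereP I J A w B : simplices I A -> mindcoset gen I J w ->
  gsphere gen delta A J w B <-> simplices J B /\
    exists C D, [/\ chambers_at A C, chambers_at B D & delta C D = w].
Proof.
move=> sA min; have cA : cotype A = I := sA.2.
(* A single suitable [x] keeps [xget] off its default 1, so [sdelta] has its defining property. *)
have sdeltaP x C D : cotype B = J -> mindcoset gen I J x -> chambers_at A C ->
    chambers_at B D -> delta C D = x -> mindcoset gen I J (sdelta gen delta A B) /\
      exists C D,
        [/\ chambers_at A C, chambers_at B D & delta C D = sdelta gen delta A B].
  move=> cB minx CA DB CD; pose P := [set x | mindcoset gen I J x /\
    exists C D, [/\ chambers_at A C, chambers_at B D & delta C D = x]].
  have : P (xget 1 P) by apply: (@xgetI _ _ P x); split=> //; exists C, D.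
  by rewrite /sdelta cA cB.
split=> -[sB].
  move=> wE; split=> //; have [C CA] := chambers_at_neq0 sA.
  have [D DB] := chambers_at_neq0 sB.
  have [x /(dcoset_delta sA sB CA DB)[C' [D' [CA' DB' E]]] xmin] :=
    exists_mindcoset cox I J (delta C D).
  by have [_] := sdeltaP x C' D' sB.2 xmin CA' DB' E; rewrite wE.
move=> [C [D [CA DB CD]]]; split=> //.
have [minB [C' [D' [CA' DB' E]]]] := sdeltaP w C D sB.2 min CA DB CD.
(* If [w] and [sdelta] differed, each would be strictly shorter than the other, both being minimal
   in one double coset. *)
have := delta_dcoset sA sB CA CA' DB DB'; have := delta_dcoset sA sB CA' CA DB' DB.
rewrite CD E => /minB lt' /min lt; apply: contrapT => ne.
by have := ltn_trans (lt ne) (lt' (nesym ne)); rewrite ltnn.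
Qed.

(** * Counting pairs of chambers in two ways *)

Section Sphere.
Variables (I J : {set S}) (A : set (vertex X)) (w : W).
Hypothesis sphI : spherical gen I.
Hypothesis sA : simplices I A.
Hypothesis min : mindcoset gen I J w.
Let K := capconj gen I w J.

Definition sphere_pairs : set (set (vertex X) * set (vertex X)) :=
  [set p | chambers_at A p.1 /\ wsphere delta p.1 w p.2].

Lemma card_sphere_pairs : sphere_pairs #= `I_(qsum gen q I * qprod gen q w).
Proof.
apply: (@card_fibration_cst _ _ _ (chambers_at A) (fun p C => p.1 = C)).
- by move=> p [pA _]; exists p.1.
- by move=> p C D _ _ _ <-.
- move=> C CA.
  apply/(@card_image_inj _ _ (wsphere delta C w) _ (pair C));
    last exact: card_wsphere CA.1.
  + by [].
  + by move=> [C' D] [[/= _ CD] <-]; exists D.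
  + by move=> D D' _ _ [].
- have [C CA] := chambers_at_neq0 sA.
  have -> : chambers_at A = [set D | ch D /\ parabolic gen I (delta C D)].
    by apply/seteqP; split=> D /(chambers_at_residue bld sA CA).
  exact: card_residue CA.1 sphI.
Qed.

Lemma spherical_capconj : spherical gen K.
Proof.
apply: sub_finite_set sphI; apply: (parabolicS cox).
by apply/fintype.subsetP => s; rewrite inE => /andP[].
Qed.

(** For a fixed pair [C0], [D0] at distance [w], put [u = delta C0 C] and [v = delta D0 D]. Both
    [u * w] and [w * v] equal [delta C0 D], so Kilmoyer's lemma puts [u] in [W_K]. The pairs with
    given [u] correspond to the chambers [C] at distance [u] from [C0]. *)
Lemma card_sphere_pairs_at B : gsphere gen delta A J w B ->
  [set p | sphere_pairs p /\ B `<=` p.2] #= `I_(qsum gen q K).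
Proof.
move=> /(gsphereP _ sA min)[sB [C0 [D0 [CA0 DB0 CD0]]]].
apply: (@card_fibration _ _ _ (parabolic gen K) (fun p u => delta C0 p.1 = u)).
- move=> [C D] [[/= CA [cD CD]] BD]; exists (delta C0 C) => //.
  have [_ Iu] := (chambers_at_residue bld sA CA0 C).1 CA.
  have [_ Jv] := (chambers_at_residue bld sB DB0 D).1 (conj cD BD).
  apply: (parabolic_capconj cox min Iu Jv).
  have := delta_cat cox bld CA0.1 CA.1 cD; rewrite CD => <-; last first.
    exact: mindcoset_lenl cox _ _ _ _ min Iu.
  have := delta_cat cox bld CA0.1 DB0.1 cD; rewrite CD0 => <- //.
  exact: mindcoset_lenr cox _ _ _ _ min Jv.
- by move=> p u v _ _ _ <-.
- move=> u Ku; have [Iu [v Jv uv]] := capconjP cox Ku.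
  apply/(@card_image_inj _ _ _ (wsphere delta C0 u) fst);
    last exact: card_wsphere CA0.1.
  + by move=> [C D] [[[/= CA [cD CD]] BD] C0C]; split=> //; exact: CA.1.
  (* From [delta C D0 = w * v^-1], with lengths adding up, the splitting yields a [D] at distance
     [w] from [C] and in the residue of [D0]. *)
  + move=> C [cC C0C].
    have CA : chambers_at A C.
      by apply/(chambers_at_residue bld sA CA0); rewrite C0C.
    have uvV : u^-1 * w = w * v^-1.
      by apply: (mulgI u); rewrite mulVKg mulgA uv mulgK.
    have CD0E : delta C D0 = w * v^-1.
      rewrite -uvV -CD0 -C0C -(deltaV cox bld CA0.1 cC).
      apply: (delta_cat cox bld) => //.
      * exact: CA0.1.
      * exact: DB0.1.
      * rewrite (deltaV cox bld CA0.1 cC) C0C CD0.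
        exact: (mindcoset_lenl cox min (parabolicV cox Iu)).
    have [|D [cD CD DD0]] := delta_split cox bld cC DB0.1 _ CD0E.
      exact: (mindcoset_lenr cox min (parabolicV cox Jv)).
    exists (C, D) => //; split=> //; split=> //.
    have [] // : chambers_at B D.
    apply/(chambers_at_residue bld sB DB0); split=> //.
    by rewrite (deltaV cox bld cD DB0.1) DD0 invgK.
  (* With [C = C'], lengths adding up give [w = w * delta D D'], hence [D = D']. *)
  + move=> [C D] [C' D'].
    move=> [[[/= CA [cD CD]] BD] _] [[[/= _ [cD' CD']] BD'] _] CC'.
    rewrite -CC' in CD' *; congr (_, _); apply/(delta1 bld) => //.
    have [_ Jv'] :=
      (chambers_at_residue bld sB (conj cD BD) D').1 (conj cD' BD').
    have := delta_cat cox bld CA.1 cD cD'; rewrite CD CD'.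
    rewrite (mindcoset_lenr cox min Jv') => /(_ erefl) E.
    by apply: (mulgI w); rewrite -E mulg1.
- exact: spherical_capconj.
Qed.

Lemma card_gsphere : exists2 n, gsphere gen delta A J w #= `I_n &
  (qsum gen q I * qprod gen q w = n * qsum gen q K)%N.
Proof.
have F_face p : sphere_pairs p -> gsphere gen delta A J w (face J p.2).
  move=> [pA [cp pw]]; apply/(gsphereP _ sA min); split; first exact: face_simplices.
  by exists p.1, p.2; split=> //; split=> // x [].
(* Every simplex of the sphere is the face of cotype [J] of the second chamber of some pair, so
   finiteness follows from that of the pairs. *)
have [n Fn] : finite_set (gsphere gen delta A J w).
  apply: (@sub_finite_set _ _ ((fun p => face J p.2) @` sphere_pairs)).
    move=> B /(gsphereP _ sA min)[sB [C [D [CA DB CD]]]]; exists (C, D).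
      by split=> //; split=> //; exact: DB.1.
    by apply/esym/face_unique => //; case: DB.
  apply: finite_image; exists (qsum gen q I * qprod gen q w)%N.
  exact: card_sphere_pairs.
exists n => //; apply/card_eq_II.
apply: card_eq_trans (card_esym card_sphere_pairs) _.
apply: (@card_fibration_cst _ _ _ _ (fun p B => B `<=` p.2)
  _ _ _ _ card_sphere_pairs_at Fn).
- by move=> p Pp; exists (face J p.2); [exact: F_face|move=> x []].
- move=> p B B' [_ [cp _]] [sB _] [sB' _] Bp Bp'.
  by rewrite (face_unique cp sB Bp) (face_unique cp sB' Bp').
Qed.

End Sphere.

End Counts.

Local Open Scope ring_scope.

Theorem theorem2p1 (W : groupType) (S : finType) (gen : S -> W)
    (X : typed_complex S) (delta : set (vertex X) -> set (vertex X) -> W)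
    (q : S -> nat) (I J : {set S}) (A : set (vertex X)) (w : W)
    (cox : coxeter_system gen) (bld : building gen delta) (reg : regular X q)
    (sphI : spherical gen I) (hA : simplices I A) (hw : mindcoset gen I J w) :
  exists n : nat, gsphere gen delta A J w #= `I_n /\
    n%:R = (qsum gen q I)%:R / (qsum gen q (capconj gen I w J))%:R
             * (qprod gen q w)%:R :> rat.
Proof.
have [n Fn E] := card_gsphere cox bld reg sphI hA hw.
exists n; split=> //.
(* A nonzero denominator is needed to cancel it in [rat]. *)
have K0 : (qsum gen q (capconj gen I w J))%:R != 0 :> rat.
  rewrite Num.Theory.pnatr_eq0 -lt0n.
  exact: (qsum_gt0 cox bld reg (spherical_capconj cox J w sphI)).
by rewrite mulrAC -natrM E natrM mulfK.
Qed.
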